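(* Consider the secure distributed linearly separable computation problem with $\mathsf K_{\rm c}=1$, $\mathsf M=\frac{\mathsf K}{\mathsf N}\mathsf M'$ where $\mathsf M'=\mathsf N-\mathsf N_{\rm r}+1$, and suppose $\frac{\mathsf M'}{\gcd(\mathsf N,\mathsf M')}\le 4$. Then the minimum randomness size among secure schemes achieving the optimal communication cost is $\eta^\star=h(\mathsf N,\mathsf M')-1$, where $h$ is the function defined below.
   Context: Problem setting. $\mathsf K,\mathsf N,\mathsf N_{\rm r}$ are positive integers with $\mathsf N_{\rm r}\le \mathsf N$ and $\mathsf N$ dividing $\mathsf K$. Fix a prime power $\mathsf q$ (sufficiently large) and a positive integer $\mathsf L$. Datasets $D_1,\dots,D_{\mathsf K}$ are independent; message $W_k=f_k(D_k)\in\mathbb F_{\mathsf q}^{\mathsf L}$, with $W_1,\dots,W_{\mathsf K}$ mutually independent and uniform over $\mathbb F_{\mathsf q}^{\mathsf L}$. The user wants $W_1+\cdots+W_{\mathsf K}$. A secure scheme consists of an assignment $\mathcal Z_n\subseteq[\mathsf K]$, $|\mathcal Z_n|\le\mathsf M$; a random variable $Q$ on a finite set independent of the datasets, given to all servers but not the user; transmissions $X_n=\psi_n(\{W_k:k\in\mathcal Z_n\},Q)\in\mathbb F_{\mathsf q}^{\mathsf T_n}$; decodability from $\{X_n:n\in\mathcal A\}$ for every $\mathcal A\subseteq[\mathsf N]$, $|\mathcal A|=\mathsf N_{\rm r}$; security $I(W_1,\dots,W_{\mathsf K};X_1,\dots,X_{\mathsf N}\mid W_1+\cdots+W_{\mathsf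 K})=0$. Communication cost $\mathsf R=\max_{|\mathcal A|=\mathsf N_{\rm r}}\sum_{n\in\mathcal A}\mathsf T_n/\mathsf L$; randomness size $\eta=H(Q)/\mathsf L$ ($\mathsf q$-ary units). $\mathsf R^\star$ is the minimum communication cost over secure schemes and $\eta^\star$ the minimum of $\eta$ over secure schemes with $\mathsf R=\mathsf R^\star$. The function $h$: for integers $1\le m\le n$, define $h(n,m)$ recursively, applying the first applicable rule: (1) if $g=\gcd(n,m)>1$, $h(n,m)=h(n/g,m/g)$; (2) if $m=1$, $h(n,1)=n$; (3) if $n>2m$, $h(n,m)=h\big(n-\lfloor n/m-1\rfloor m,\,m\big)+\lfloor n/m-1\rfloor$; (4) if $1.5m\le n<2m$ and $m$ is even, $h(n,m)=h(n-m,m/2)+1$; (5) if $1.5m\le n<2m$ and $m$ is odd, $h(n,m)=n-\frac{3m-5}{2}$; (6) if $m<n<1.5m$, $h(n,m)=h(m,2m-n)$. *)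

(* Defs.v *)
From HB Require Import structures.
From mathcomp Require Import all_boot all_order all_algebra.
From mathcomp Require Import Rstruct.
From Stdlib Require Rdefinitions Rpower.

Set Implicit Arguments.
Unset Strict Implicit.
Unset Printing Implicit Defensive.

Import Order.TTheory GRing.Theory Num.Theory.
(* The function h, by fuel-bounded recursion (n strictly decreases at  *)
(* every recursive call, so fuel n.+1 suffices).                       *)
Fixpoint hfuel (fuel n m : nat) {struct fuel} : nat :=
  match fuel with
  | 0 => 0%N
  | fuel'.+1 =>
    let g := gcdn n m in
    if (1 < g)%N then hfuel fuel' (n %/ g) (m %/ g)
    else if m == 1%N then n
    else if (2 * m < n)%N then
      (hfuel fuel' (n - (n %/ m - 1) * m) m + (n %/ m - 1))%N
    else if (3 * m <= 2 * n)%N && (n < 2 * m)%N then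
      (if ~~ odd m then (hfuel fuel' (n - m) (m %/ 2) + 1)%N
       else (n - (3 * m - 5) %/ 2)%N)
    else (* m < n < 1.5 m *) hfuel fuel' m (2 * m - n)
  end.

(* h(n,m) for integers 1 <= m <= n *)
Definition h (n m : nat) : nat := hfuel n.+1 n m.

Local Open Scope ring_scope.

(* F : finite field F_q, K datasets/messages, N servers, L = message   *)
(* length. Messages W = (W_1..W_K), W_k in F^L, i.i.d. uniform.        *)
Definition Msg (F : finFieldType) (K L : nat) := {ffun 'I_K -> 'rV[F]_L}.

Definition msum (F : finFieldType) (K L : nat) (w : Msg F K L) : 'rV[F]_L :=
  \sum_(k < K) w k.

(* A scheme: assignment Z_n, common randomness Q on the finite set 'I_qn *)
(* with pmf pQ (independent of the data), lengths T_n and encoders psi_n. *)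
Unset Implicit Arguments.
Record scheme (F : finFieldType) (K N L : nat) := Scheme {
  Z : 'I_N -> {set 'I_K};
  qn : nat;
  pQ : 'I_qn -> Rdefinitions.R;
  T : 'I_N -> nat;
  psi : forall n : 'I_N, Msg F K L -> 'I_qn -> 'rV[F]_(T n)
}.
Set Implicit Arguments.
Arguments Z {F K N L} s _.
Arguments qn {F K N L} s.
Arguments pQ {F K N L} s _.
Arguments T {F K N L} s _.
Arguments psi {F K N L} s n _ _.

Section Info.
Variables (F : finFieldType) (K N L : nat) (S : scheme F K N L).

Definition pw (w : Msg F K L) (q : 'I_(qn S)) : Rdefinitions.R :=
  pQ S q / (#|{: Msg F K L}|)%:R.

Definition prob (E : Msg F K L -> 'I_(qn S) -> bool) : Rdefinitions.R :=
  \sum_(w : Msg F K L) \sum_(q : 'I_(qn S)) (if E w q then pw w q else 0).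

(* Shannon entropy (natural log) of a random variable X = X(W,Q):       *)
(* H(X) = - sum_x P(X=x) ln P(X=x) = - E[ln P(X = X(W,Q))].              *)
Definition ent (V : eqType) (X : Msg F K L -> 'I_(qn S) -> V) : Rdefinitions.R :=
  - \sum_(w : Msg F K L) \sum_(q : 'I_(qn S))
      pw w q * Rpower.ln (prob (fun w' q' => X w' q' == X w q)).

Definition cmi (V1 V2 V3 : eqType) (X : Msg F K L -> 'I_(qn S) -> V1)
  (Y : Msg F K L -> 'I_(qn S) -> V2) (Zv : Msg F K L -> 'I_(qn S) -> V3) : Rdefinitions.R :=
  ent (fun w q => (X w q, Zv w q)) + ent (fun w q => (Y w q, Zv w q))
  - ent (fun w q => (X w q, Y w q, Zv w q)) - ent Zv.

Definition Xall (w : Msg F K L) (q : 'I_(qn S))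
  : {dffun forall n : 'I_N, 'rV[F]_(T S n)} :=
  [ffun n => psi S n w q].

Definition is_pmf : Prop :=
  (forall q, 0 <= pQ S q) /\ \sum_(q < qn S) pQ S q = 1.

Definition storage_ok (M : nat) : Prop := forall n, (#|Z S n| <= M)%N.

Definition local_encoding : Prop :=
  forall n (w w' : Msg F K L) q, (forall k, k \in Z S n -> w k = w' k) ->
    psi S n w q = psi S n w' q.

Definition decodable (Nr : nat) : Prop :=
  forall A : {set 'I_N}, #|A| = Nr ->
    exists dec : {dffun forall n : 'I_N, 'rV[F]_(T S n)} -> 'rV[F]_L,
      (forall x x' : {dffun forall n : 'I_N, 'rV[F]_(T S n)}, (forall n, n \in A -> x n = x' n) -> dec x = dec x') /\
      (forall w q, 0 < pQ S q -> dec (Xall w q) = msum w).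

Definition secure_cond : Prop :=
  cmi (fun w (q : 'I_(qn S)) => w) Xall (fun w (q : 'I_(qn S)) => msum w) = 0.

Definition secure_scheme (M Nr : nat) : Prop :=
  [/\ is_pmf, storage_ok M, local_encoding, decodable Nr & secure_cond].

Definition comm_cost (Nr : nat) : Rdefinitions.R :=
  (\max_(A : {set 'I_N} | #|A| == Nr) \sum_(n in A) T S n)%N%:R / L%:R.

(* Randomness size eta = H(Q)/L in q-ary units, q = |F|. *)
Definition rand_size : Rdefinitions.R :=
  ent (fun (w : Msg F K L) (q : 'I_(qn S)) => q) / (L%:R * Rpower.ln (#|{: F}|)%:R).

End Info.

Definition comm_optimal (F : finFieldType) (K N L M Nr : nat)
  (S : scheme F K N L) : Prop :=
  secure_scheme S M Nr /\
  forall S' : scheme F K N L, secure_scheme S' M Nr ->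
    comm_cost S Nr <= comm_cost S' Nr.

(* Main.v *)
Require Import Defs.
From HB Require Import structures.
From mathcomp Require Import all_boot all_order all_algebra.
From mathcomp Require Import zify ring Rstruct.
From Stdlib Require Rdefinitions Rpower.
Import Order.TTheory GRing.Theory Num.Theory.

(* Converse. If each server of a sequence of l servers stores a dataset that no
   earlier one stores, then, the randomness being fixed, the transmissions of the
   sequence determine l messages from the others, so every value of (X_1, ..., X_N)
   has probability at most q^(-l L). With security this gives
   H(Q) >= H(X, sum W) - H(sum W) >= (l - 1) L. Decodability and the storage bound
   force every dataset to be stored exactly M' times, and a counting argument then
   produces a sequence of length l = h(N, M').

   Achievability. Take vectors p_k and functionals u, s_j in dimension d = h(N, M')
   with u(p_k) = 1, where s_j(p_k) = 0 unless server j stores dataset k, and such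
   that u(v) = 1 implies s_j(v) <> 0 for at least M' values of j. Server j sends
   s_j (sum_k p_k W_k + Q), Q being uniform on ker u. Any N - M' + 1 of the s_j span u,
   which gives decoding; what is revealed besides sum_k W_k is masked by Q. The
   configurations come from two kinds of basic ones by replication and by direct
   sums, which add the dimensions: monic polynomials of degree N - M' evaluated at N
   points, and for (N, M') = (7, 4), in the affine plane u = 1, three lines through a
   point and two parallel lines counted twice. *)

Set Implicit Arguments.
Unset Strict Implicit.
Unset Printing Implicit Defensive.

(** * The function h and chains of servers *)

(** Closed form of [h] valid when [m %/ gcdn n m <= 4]. Unlike the recursion, it makes the behaviour
    under scaling and under n -> n + m immediate. *)
Definition hval (n m : nat) : nat :=
  n %/ m + (n %% m != 0) + (m < 2 * (n %% m)).

Lemma hval_scale g n m : 0 < g -> hval (g * n) (g * m) = hval n m.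
Proof.
move=> g0; rewrite /hval divnMl // -muln_modr muln_eq0 mulnCA ltn_pmul2l //.
by case: g g0.
Qed.

Lemma hvalDl n m : 0 < m -> hval (m + n) m = (hval n m).+1.
Proof. by move=> m0; rewrite /hval divnDl // divnn m0 modnDl. Qed.

(** The bounds leave finitely many pairs, each settled by computation. *)
Lemma hfuel_base f n m : m <= n < 2 * m -> n < f -> coprime n m -> m <= 4 ->
  hfuel f n m = hval n m.
Proof.
case: m => [|[|[|[|[|m]]]]] //; case: n => [|[|[|[|[|[|[|[|n]]]]]]]] //; try lia.
all: case: f => [|[|[|[|[|[|[|[|f]]]]]]]] //; try lia.
Qed.

Lemma hfuel_step f n m : 1 < m -> 2 * m < n -> coprime n m ->
  hfuel f.+1 n m = hfuel f (n - (n %/ m - 1) * m) m + (n %/ m - 1).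
Proof.
move=> m1 nm cop /=; rewrite (eqP cop) ltnn nm; case: eqP => // E; lia.
Qed.

Lemma hfuel_coprime f n m : 0 < m -> m <= n -> n < f -> coprime n m -> m <= 4 ->
  hfuel f n m = hval n m.
Proof.
move=> m0 mn nf cop m4.
have [n2m|] := ltnP n (2 * m); first by apply: hfuel_base; rewrite ?mn.
rewrite leq_eqVlt => /predU1P[nE|n2m].
  (* n = 2m is coprime to m only when m = 1. *)
  move: cop; rewrite -nE coprimeMl [coprime m m]/coprime gcdnn => /andP[_ /eqP m1].
  rewrite -nE m1 /hval in nf *.
  by case: f nf.
have [m1|m1] := leqP m 1.
  have -> : m = 1 by lia.
  by case: f nf => // f _ /=; rewrite gcdn1 /hval divn1 modn1 !addn0.
case: f nf => // f nf; rewrite hfuel_step //.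
have k1 : 0 < n %/ m by rewrite divn_gt0.
have nE := divn_eq n m; have r_lt := ltn_pmod n m0.
(* A single reduction by multiples of m lands in the range of [hfuel_base]. *)
have -> : n - (n %/ m - 1) * m = m + n %% m.
  by rewrite mulnBl mul1n; nia.
have cop' : coprime (m + n %% m) m by rewrite /coprime gcdnC gcdnDl gcdn_modr gcdnC.
rewrite hfuel_base // ?leq_addr //=; last 2 first.
- by rewrite mul2n -addnn ltn_add2l.
- by nia.
rewrite hvalDl // /hval modn_mod divn_small // add0n.
by lia.
Qed.

Lemma h_hval n m : 0 < m -> m <= n -> m %/ gcdn n m <= 4 -> h n m = hval n m.
Proof.
move=> m0 mn m4; have n0 : 0 < n by apply: leq_trans mn.
have g0 : 0 < gcdn n m by rewrite gcdn_gt0 m0 orbT.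
have cop : coprime (n %/ gcdn n m) (m %/ gcdn n m).
  rewrite /coprime -(eqn_pmul2l g0) muln1 muln_gcdr.
  by rewrite ![gcdn n m * _]mulnC !divnK ?dvdn_gcdl ?dvdn_gcdr.
have mg0 : 0 < m %/ gcdn n m by rewrite divn_gt0 // dvdn_leq // dvdn_gcdr.
have le_mn : m %/ gcdn n m <= n %/ gcdn n m by apply: leq_div2r.
have [g1|g1] := ltnP 1 (gcdn n m).
  rewrite /h /= g1 hfuel_coprime //; last by apply: ltn_Pdiv.
  rewrite -(hval_scale _ _ g0) ![gcdn n m * _]mulnC.
  by rewrite !divnK ?dvdn_gcdl ?dvdn_gcdr.
have gE : gcdn n m = 1 by lia.
by move: m4; rewrite gE divn1 => m4; apply: hfuel_coprime => //; apply/eqP.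
Qed.

(** * Long chains of servers, by counting *)

Section Chains.
Variables (N K : nat) (Z : 'I_N -> {set 'I_K}).

Definition covered (s : seq 'I_N) : {set 'I_K} := \bigcup_(x <- s) Z x.

(* The most recent server is at the head. *)
Fixpoint chain (s : seq 'I_N) : bool :=
  if s is x :: s' then ~~ (Z x \subset covered s') && chain s' else true.

Lemma covered_cons x s : covered (x :: s) = Z x :|: covered s.
Proof. by rewrite /covered big_cons. Qed.

Variables (c m : nat).
Hypotheses (m_gt0 : 0 < m) (KE : K = c * N).
Hypothesis card_Z : forall x, #|Z x| <= c * m.
Hypothesis card_servers : forall k, #|[set x | k \in Z x]| = m.

Lemma card_covered s : #|covered s| <= c * m * size s.
Proof.
elim: s => [|x s IHs]; first by rewrite /covered big_nil cards0.
rewrite covered_cons /= mulnS (leq_trans (leq_card_setU _ _)) //.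
by rewrite leq_add.
Qed.

Lemma exists_server k : exists x, k \in Z x.
Proof.
have: 0 < #|[set x | k \in Z x]| by rewrite card_servers.
by case/card_gt0P=> x; rewrite inE; exists x.
Qed.

Lemma chain_consP x s k : chain s -> k \in Z x -> k \notin covered s -> chain (x :: s).
Proof. by move=> /= -> kx ks; rewrite andbT; apply/subsetPn; exists k. Qed.

Lemma exists_uncovered s : c * m * size s < K -> exists k, k \notin covered s.
Proof.
move=> lt_s; have : 0 < #|~: covered s|.
  by have := cardsC (covered s); have := card_covered s; rewrite card_ord; lia.
by case/card_gt0P=> k; rewrite inE; exists k.
Qed.

(** Greedy choice: fewer than l servers cover at most c m (l - 1) < K datasets, so some dataset is
    uncovered and any server storing it prolongs the chain. *)
Lemma chain_extend s l : chain s -> size s <= l -> c * m * l.-1 < K ->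
  exists t, [/\ chain t, size t = l & covered s \subset covered t].
Proof.
move=> chs; elim: l => [|l IHl] sl lt_l; first by exists s; split=> //; lia.
move: sl; rewrite leq_eqVlt => /predU1P[sl|sl]; first by exists s; split.
have [|t [cht tl st]] := IHl sl; first by rewrite (leq_ltn_trans _ lt_l) // leq_mul2l /=; lia.
have [|k kt] := @exists_uncovered t; first by rewrite tl.
have [x kx] := exists_server k.
exists (x :: t); split; [exact: chain_consP kx kt | by rewrite /= tl |].
by rewrite covered_cons; apply: subset_trans st (subsetUr _ _).
Qed.

Lemma divn_chain l : 0 < c -> l * m < N -> exists s, chain s /\ size s = l.+1.
Proof.
move=> c0 lm; have [|||s [? ? _]] := @chain_extend [::] l.+1 => //.
  by rewrite KE /= -mulnA ltn_pmul2l // mulnC.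
by exists s.
Qed.

(* If no chain can be that long, what a chain of length N %/ m leaves uncovered
   is stored as a whole or not at all by each server; with 2 (N %% m) > m two
   disjoint such leftovers do not fit in one server, which gives
   (N %/ m).+1 disjoint groups of m servers each. *)
Lemma long_chain : 0 < c -> m < 2 * (N %% m) ->
  exists s, chain s /\ size s = (N %/ m).+2.
Proof.
move=> c0 r2; set k := N %/ m; set r := N %% m in r2.
have NE : N = k * m + r by apply: divn_eq.
pose long := exists s, chain s /\ size s = k.+2.
(* [B] is the union of the j groups found so far; each of its servers spends at least c r of its
   storage on [covered s]. For j = k + 1, [B] would have more than N elements. *)
suff H j : j <= k.+1 -> long \/ exists s (B : {set 'I_N}),
    [/\ chain s, size s = j, #|B| = j * m
      & forall y, y \in B -> c * r <= #|Z y :&: covered s|].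
  case: (H k.+1 (leqnn _)) => // -[s [B [_ _ cB _]]].
  by have := max_card (mem B); rewrite card_ord cB; lia.
elim: j => [|j IHj] jk.
  by right; exists [::], set0; split; rewrite ?cards0 // => y; rewrite inE.
case: (IHj (ltnW jk)) => [?|[s [B [chs sj cB HB]]]]; first by left.
have [||t [cht tk st]] := @chain_extend s k chs; rewrite ?sj //.
  by rewrite KE -mulnA ltn_pmul2l //; nia.
pose U := ~: covered t.
have cU : c * r <= #|U|.
  have := cardsC (covered t); have := card_covered t.
  have KE' : K = c * (k * m + r) by rewrite -NE.
  by rewrite card_ord tk -/U; nia.
have [u uU] : exists u, u \in U by apply/card_gt0P; nia.
have [x ux] := exists_server u.
(* Either every server storing u stores the whole leftover U, and these servers form the next group,
   or some y stores u and misses a v in U. *)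
case: (boolP [forall y, (u \in Z y) ==> (U \subset Z y)]) => [/forallP atom|].
  have {}atom y : u \in Z y -> U \subset Z y by apply/implyP.
  right; exists (x :: s), (B :|: [set y | u \in Z y]); split.
  - apply: chain_consP ux _ => //.
    by apply: contraL uU => us; rewrite inE negbK (subsetP st).
  - by rewrite /= sj.
  - rewrite cardsU card_servers cB.
    (* A server in both sets would store c r datasets of [covered s] and, disjoint from them, all of
       U: at least 2 c r > c m in total. *)
    suff -> : B :&: [set y | u \in Z y] = set0 by rewrite cards0; lia.
    apply/setP=> y; rewrite !inE; apply/negP => /andP[/HB cy uy].
    have : #|(Z y :&: covered s) :|: U| <= #|Z y|.
      by apply: subset_leq_card; rewrite subUset subsetIl atom.
    rewrite cardsU (_ : _ :&: U = set0) ?cards0; first by have := card_Z y; nia.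
    apply/setP=> z; rewrite !inE; apply/negP => /andP[/andP[_ /(subsetP st) zt]].
    by rewrite zt.
  - move=> y; rewrite !inE covered_cons => /orP[/HB cy|/atom Uy].
      by apply: leq_trans cy _; apply: subset_leq_card; rewrite setIS // subsetUr.
    apply: leq_trans cU _; apply: subset_leq_card.
    by rewrite subsetI Uy (subset_trans (atom _ ux)) // subsetUl.
rewrite negb_forall => /existsP[y]; rewrite negb_imply => /andP[uy /subsetPn[v vU vy]].
have [z vz] := exists_server v.
(* y contributes u and z contributes v, so t grows by two. *)
left; exists [:: z, y & t]; split; last by rewrite /= tk.
apply: chain_consP vz _; first by apply: chain_consP uy _ => //; rewrite inE in uU.
by rewrite covered_cons inE negb_or vy; rewrite inE in vU.
Qed.

Lemma hval_chain : 0 < c -> exists s, chain s /\ size s = hval N m.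
Proof.
move=> c0; rewrite /hval; have NE := divn_eq N m.
have [r0|r0] := eqVneq (N %% m) 0.
  rewrite r0 /= !addn0; case k0 : (N %/ m) => [|k]; first by exists [::].
  by apply: divn_chain => //; nia.
have [r2|r2] := ltnP m (2 * (N %% m)); rewrite ?addn1 ?addn0.
  exact: long_chain.
by apply: divn_chain => //; move: NE r0; lia.
Qed.

End Chains.

Local Open Scope ring_scope.
Local Notation R := Rdefinitions.R.
Local Notation ln := Rpower.ln.

(** * Entropy of a scheme *)

Lemma lnM (x y : R) : 0 < x -> 0 < y -> ln (x * y) = ln x + ln y.
Proof. by move=> /RltP x0 /RltP y0; apply: Rpower.ln_mult. Qed.

Lemma ln1 : ln (1 : R) = 0.
Proof. exact: Rpower.ln_1. Qed.

Lemma lnV (x : R) : 0 < x -> ln x^-1 = - ln x.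
Proof.
by move=> x0; apply/eqP; rewrite -addr_eq0 addrC -lnM ?invr_gt0 // divff ?ln1 // gt_eqF.
Qed.

Lemma lnX (x : R) n : 0 < x -> ln (x ^+ n) = n%:R * ln x.
Proof.
move=> x0; elim: n => [|n IHn]; first by rewrite mul0r ln1.
by rewrite exprS lnM ?exprn_gt0 // IHn -natr1 mulrDl mul1r addrC.
Qed.

Lemma ler_ln (x y : R) : 0 < x -> x <= y -> ln x <= ln y.
Proof.
move=> x0; rewrite le_eqVlt => /predU1P[-> //|xy]; apply/ltW/RltP.
by apply: Rpower.ln_increasing; apply/RltP.
Qed.

Lemma ln_gt0 (x : R) : 1 < x -> 0 < ln x.
Proof. by move=> x1; rewrite -ln1; apply/RltP; apply: Rpower.ln_increasing; apply/RltP. Qed.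

(** The maps t inject every fibre into every other one, so all fibres have the same size. *)
Lemma card_uniform_fiber (U V : finType) (f : U -> V) :
  (forall v v', exists2 t : U -> U, injective t & forall u, f u = v -> f (t u) = v') ->
  forall v, (#|[set u | f u == v]| * #|V|)%N = #|U|.
Proof.
move=> shift v.
have le_fib v1 v2 : (#|[set u | f u == v1]| <= #|[set u | f u == v2]|)%N.
  have [t tI ft] := shift v1 v2; rewrite -(card_imset _ tI).
  apply: subset_leq_card; apply/subsetP=> _ /imsetP[u uv1 ->].
  by move: uv1; rewrite !inE => /eqP/ft ->.
rewrite mulnC -sum_nat_const -[RHS]sum1_card (partition_big f xpredT) //=.
apply: eq_bigr => v' _; transitivity #|[set u | f u == v']|.
  by apply/eqP; rewrite eqn_leq !le_fib.
by rewrite -sum1_card; apply: eq_bigl => u; rewrite !inE.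
Qed.

Section Info.
Variables (F : finFieldType) (K N L : nat).
Notation V := 'rV[F]_L.
Notation Msg := (Msg F K L).

Lemma card_Msg : #|{: Msg}| = (#|{: V}| ^ K)%N.
Proof. by rewrite card_ffun card_ord. Qed.

Lemma card_V : #|{: V}| = (#|{: F}| ^ L)%N.
Proof. by rewrite card_mx mul1n. Qed.

Lemma card_V_gt0 : (0 < #|{: V}|)%N.
Proof. by rewrite card_V expn_gt0 (leq_trans _ (card_finNzRing_gt1 F)). Qed.

Lemma card_Msg_gt0 : (0 < #|{: Msg}|)%N.
Proof. by rewrite card_Msg expn_gt0 card_V_gt0. Qed.

Lemma card_msum_fiber (v : V) : (0 < K)%N ->
  (#|[set w : Msg | msum w == v]| * #|{: V}|)%N = #|{: Msg}|.
Proof.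
case: K => // k _; apply: card_uniform_fiber => x y.
pose d : {ffun 'I_k.+1 -> V} := [ffun i => if i == ord0 then y - x else 0].
have sum_d : \sum_i d i = y - x.
  rewrite (bigD1 ord0) //= ffunE eqxx big1 ?addr0 // => i /negbTE i0.
  by rewrite ffunE i0.
exists (fun w : {ffun 'I_k.+1 -> V} => w + d); first exact: addIr.
move=> w wx; transitivity (msum w + \sum_i d i).
  by rewrite /msum -big_split; apply: eq_bigr => i _; rewrite !ffunE.
by rewrite sum_d wx addrC subrK.
Qed.

Variable S : scheme F K N L.
Notation q_t := ('I_(qn S)).
Notation prob := (@prob F K N L S).
Notation ent := (@ent F K N L S _).
Notation pw := (@pw F K N L S).
Notation Xall := (@Xall F K N L S).
Notation card_W := (#|{: Msg}|%:R : R).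

Hypothesis pS : is_pmf S.

Let pQ_ge0 q : 0 <= pQ S q. Proof. exact: pS.1. Qed.
Let sum_pQ : \sum_q pQ S q = 1. Proof. exact: pS.2. Qed.
Let card_W_gt0 : 0 < card_W. Proof. by rewrite ltr0n card_Msg_gt0. Qed.
Let card_W_neq0 : card_W != 0. Proof. by rewrite gt_eqF. Qed.

Lemma probE (E : Msg -> q_t -> bool) :
  prob E = (\sum_q pQ S q * (#|[set w | E w q]|)%:R) / card_W.
Proof.
rewrite /prob exchange_big mulr_suml; apply: eq_bigr => q _.
rewrite -big_mkcond sumr_const /= /pw -mulrnAl -mulr_natr; congr (_ * _ * _).
by rewrite cardsE.
Qed.

Lemma prob_msg_sumE (E : Msg -> q_t -> bool) :
  prob E = (\sum_w \sum_q pQ S q *+ E w q) / card_W.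
Proof.
rewrite /prob mulr_suml; apply: eq_bigr => w _; rewrite mulr_suml.
by apply: eq_bigr => q _; rewrite /pw; case: (E w q); rewrite ?mul0r.
Qed.

Lemma pw_ge0 w q : 0 <= pw w q.
Proof. by rewrite divr_ge0. Qed.

Lemma sum_pw : \sum_w \sum_q pw w q = 1.
Proof.
rewrite (eq_bigr (fun=> card_W^-1)) => [|w _].
  by rewrite sumr_const -[LHS]mulr_natr mulVf.
by rewrite /pw -mulr_suml sum_pQ mul1r.
Qed.

Lemma sum_pwM (x : R) : \sum_w \sum_q pw w q * x = x.
Proof.
rewrite -[RHS]mul1r -sum_pw mulr_suml; apply: eq_bigr => w _.
by rewrite mulr_suml.
Qed.

Lemma pw_gt0 w q : (0 < pw w q) = (0 < pQ S q).
Proof. by rewrite pmulr_lgt0 // invr_gt0. Qed.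

Lemma prob_ge (E : Msg -> q_t -> bool) w q : E w q -> pw w q <= prob E.
Proof.
move=> Ewq; rewrite /prob (bigD1 w) //= (bigD1 q) //= Ewq -addrA lerDl.
by rewrite addr_ge0 ?sumr_ge0 // => i _; rewrite ?sumr_ge0 // => *; case: ifP; rewrite ?pw_ge0.
Qed.

Lemma prob_gt0 (E : Msg -> q_t -> bool) w q : E w q -> 0 < pQ S q -> 0 < prob E.
Proof. by rewrite -(pw_gt0 w) => /prob_ge le_E /lt_le_trans ->. Qed.

Lemma prob_le (E E' : Msg -> q_t -> bool) : (forall w q, E w q -> E' w q) ->
  prob E <= prob E'.
Proof.
move=> EE'; apply: ler_sum => w _; apply: ler_sum => q _.
by case: ifP => [/EE' -> //|_]; case: ifP; rewrite ?pw_ge0.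
Qed.

(** Entropy being the mean of -ln P, a pointwise comparison suffices, and outcomes with [pQ S q = 0]
    carry no weight. *)
Lemma ent_le (V1 V2 : eqType) (X : Msg -> q_t -> V1) (Y : Msg -> q_t -> V2) :
  (forall w q, 0 < pQ S q -> prob (fun w' q' => Y w' q' == Y w q)
     <= prob (fun w' q' => X w' q' == X w q)) -> ent X <= ent Y.
Proof.
move=> le_p; rewrite /Defs.ent lerN2; apply: ler_sum => w _; apply: ler_sum => q _.
have [q0|] := ltP 0 (pQ S q); last first.
  rewrite le_eqVlt ltNge pQ_ge0 orbF => /eqP q0.
  by rewrite /pw q0 !mul0r.
by rewrite ler_wpM2l ?pw_ge0 // ler_ln ?le_p // (@prob_gt0 _ w q).
Qed.

(** Min-entropy bounds Shannon entropy from below. *)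
Lemma ent_ge_uniform (V1 : eqType) (X : Msg -> q_t -> V1) (n : nat) : (0 < n)%N ->
  (forall w q, 0 < pQ S q -> prob (fun w' q' => X w' q' == X w q) <= n%:R^-1) ->
  ln n%:R <= ent X.
Proof.
move=> n0 le_p; rewrite -[leLHS]sum_pwM /Defs.ent -sumrN; apply: ler_sum => w _.
rewrite -sumrN; apply: ler_sum => q _; rewrite -mulrN.
have [q0|] := ltP 0 (pQ S q); last first.
  rewrite le_eqVlt ltNge pQ_ge0 orbF => /eqP q0.
  by rewrite /pw q0 !mul0r.
rewrite ler_wpM2l ?pw_ge0 // lerNr -lnV ?ltr0n //.
by rewrite ler_ln ?le_p // (@prob_gt0 _ w q).
Qed.

Lemma ent_uniform (V1 : eqType) (X : Msg -> q_t -> V1) (n : nat) : (0 < n)%N ->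
  (forall w q, prob (fun w' q' => X w' q' == X w q) = n%:R^-1) ->
  ent X = ln n%:R.
Proof.
move=> n0 le_p; rewrite -[RHS]sum_pwM /Defs.ent -sumrN; apply: eq_bigr => w _.
rewrite -sumrN; apply: eq_bigr => q _.
by rewrite le_p lnV ?ltr0n // mulrN opprK.
Qed.

Lemma prob_msg w : prob (fun w' _ => w' == w) = card_W^-1.
Proof.
rewrite probE (eq_bigr (pQ S)) ?sum_pQ ?mul1r // => q _.
by rewrite (_ : [set w' | _] = [set w]) ?cards1 ?mulr1 //; apply/setP=> ?; rewrite !inE.
Qed.

Lemma prob_q q : prob (fun _ q' => q' == q) = pQ S q.
Proof.
rewrite probE (bigD1 q) //= big1 => [|q' /negbTE q'q].
  rewrite (_ : [set w | _] = [set: Msg]) ?cardsT ?addr0 ?mulfK //.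
  by apply/setP=> ?; rewrite !inE eqxx.
by rewrite (_ : [set w | _] = set0) ?cards0 ?mulr0 //; apply/setP=> ?; rewrite !inE q'q.
Qed.

Lemma prob_pair w q : prob (fun w' q' => (w', q') == (w, q)) = pQ S q / card_W.
Proof.
rewrite probE (bigD1 q) //= big1 => [|q' /negbTE q'q].
  rewrite (_ : [set w' | _] = [set w]) ?cards1 ?addr0 ?mulr1 //.
  by apply/setP=> ?; rewrite !inE xpair_eqE eqxx andbT.
rewrite (_ : [set w' | _] = set0) ?cards0 ?mulr0 //.
by apply/setP=> ?; rewrite !inE xpair_eqE q'q andbF.
Qed.

Lemma ent_pair : ent (fun w q => (w, q)) = ln card_W + ent (fun _ q => q).
Proof.
rewrite -[ln card_W]sum_pwM /Defs.ent -!sumrN -big_split /=; apply: eq_bigr => w _.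
rewrite -!sumrN -big_split /=; apply: eq_bigr => q _.
rewrite prob_pair prob_q.
have [q0|] := ltP 0 (pQ S q); last first.
  rewrite le_eqVlt ltNge pQ_ge0 orbF => /eqP q0.
  by rewrite /pw q0 !mul0r oppr0 addr0.
by rewrite lnM ?invr_gt0 // lnV // mulrDr mulrN opprD opprK addrC.
Qed.

Lemma ent_msum : (0 < K)%N -> ent (fun w _ => msum w) = ln #|{: V}|%:R.
Proof.
move=> K0; apply: ent_uniform card_V_gt0 _ => w _.
rewrite probE (eq_bigr (fun q => pQ S q * #|[set w' : Msg | msum w' == msum w]|%:R)) //.
rewrite -mulr_suml sum_pQ mul1r -(card_msum_fiber (msum w) K0) natrM.
rewrite invfM mulrA divff ?mul1r // pnatr_eq0 -lt0n.
by apply/card_gt0P; exists w; rewrite inE.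
Qed.

Lemma ent_msg_msum : ent (fun w _ => (w, msum w)) = ln card_W.
Proof.
apply: ent_uniform card_Msg_gt0 _ => w _.
rewrite -(prob_msg w); apply: eq_bigr => w' _; apply: eq_bigr => q _.
by rewrite xpair_eqE andb_idr // => /eqP ->.
Qed.

(** Since H(W, sum W) = H(W), security reads H(X, sum W) = H(W, X, sum W) + H(sum W) - H(W).
    Moreover (W, X, sum W) is a function of (W, Q), whose entropy is H(W) + H(Q). *)
Lemma rand_ge_of_secure (l : nat) : (0 < K)%N -> secure_cond S ->
  (forall w q, 0 < pQ S q -> prob (fun w' q' => Xall w' q' == Xall w q)
     <= (#|{: V}| ^ l)%:R^-1) ->
  l%:R * ln #|{: V}|%:R - ln #|{: V}|%:R <= ent (fun _ q => q).
Proof.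
move=> K0 sec le_p; have V0 : 0 < #|{: V}|%:R :> R by rewrite ltr0n card_V_gt0.
have HX : l%:R * ln #|{: V}|%:R <= ent (fun w q => (Xall w q, msum w)).
  rewrite -lnX // -natrX; apply: ent_ge_uniform => [|w q q0].
    by rewrite expn_gt0 card_V_gt0.
  by apply: le_trans (le_p w q q0); apply: prob_le => w' q'; rewrite xpair_eqE => /andP[].
have HWX : ent (fun w q => (w, Xall w q, msum w)) <= ln card_W + ent (fun _ q => q).
  rewrite -ent_pair; apply: ent_le => w q _; apply: prob_le => w' q' /eqP[-> ->].
  exact: eqxx.
move: sec; rewrite /secure_cond /cmi ent_msg_msum ent_msum // => /eqP.
rewrite subr_eq0 => /eqP E.
rewrite lerBlDr (le_trans HX) // -E addrA lerBrDr addrA [leLHS]addrC lerD2r.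
by rewrite addrC.
Qed.

End Info.

(** * Converse *)

Lemma exists_subset_card (T : finType) (A : {set T}) n : (n <= #|A|)%N ->
  exists2 B : {set T}, B \subset A & #|B| = n.
Proof.
move=> nA; exists [set x in take n (enum A)].
  by apply/subsetP=> x; rewrite inE => /mem_take; rewrite mem_enum.
by rewrite cardsE (card_uniqP _) ?take_uniq ?enum_uniq // size_takel -?cardE.
Qed.

Section Converse.
Variables (F : finFieldType) (K N L : nat) (S : scheme F K N L) (Nr : nat).
Notation V := 'rV[F]_L.
Notation Msg := (Msg F K L).
Let M' := (N - Nr + 1)%N.
Let M := (K %/ N * M')%N.
Hypotheses (K_gt0 : (0 < K)%N) (Nr_gt0 : (0 < Nr)%N) (Nr_le : (Nr <= N)%N).
Hypotheses (NK : (N %| K)%N) (L_gt0 : (0 < L)%N).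
Hypothesis secS : secure_scheme S M Nr.

Let pS : is_pmf S. Proof. by case: secS. Qed.
Let storS : storage_ok S M. Proof. by case: secS. Qed.
Let locS : local_encoding S. Proof. by case: secS. Qed.
Let decS : decodable S Nr. Proof. by case: secS. Qed.
Let N_gt0 : (0 < N)%N. Proof. exact: leq_trans Nr_le. Qed.
Let KE : K = (K %/ N * N)%N. Proof. by rewrite divnK. Qed.

Lemma exists_pQ_gt0 : exists q, 0 < pQ S q.
Proof.
apply/existsP; apply: contra_eqT pS.2 => /existsPn q0.
rewrite big1 => [|q _]; first by rewrite eq_sym oner_eq0.
by apply/eqP; rewrite eq_le pS.1 leNgt q0.
Qed.

Lemma decode_eq (A : {set 'I_N}) (w w' : Msg) q : 0 < pQ S q -> #|A| = Nr ->
  (forall x, x \in A -> psi S x w q = psi S x w' q) -> msum w = msum w'.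
Proof.
move=> q0 /decS[dec [decA decE]] ww'; rewrite -(decE w q) // -(decE w' q) //.
by apply: decA => x xA; rewrite !ffunE ww'.
Qed.

Lemma msum_inj_at k (w w' : Msg) : (forall i, i != k -> w i = w' i) ->
  msum w = msum w' -> w = w'.
Proof.
move=> ww'; rewrite /msum (bigD1 k) //= [RHS](bigD1 k) //= (eq_bigr w') //.
move=> /addIr kk; apply/ffunP=> i; have [-> //|] := eqVneq i k.
exact: ww'.
Qed.

Definition at_msg (k : 'I_K) (v : V) : Msg := [ffun i => if i == k then v else 0].

(** Otherwise some Nr servers all lack dataset k; they cannot see a change of W_k alone, which
    alters the sum. *)
Lemma card_servers_ge k : (M' <= #|[set x | k \in Z S x]|)%N.
Proof.
rewrite leqNgt; apply/negP => lt_k.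
have [q q0] := exists_pQ_gt0.
have [|A /subsetP Ak cA] := @exists_subset_card _ (~: [set x | k \in Z S x]) Nr.
  by have := cardsC [set x | k \in Z S x]; rewrite card_ord; move: lt_k; rewrite /M'; lia.
have : at_msg k (const_mx 1) = at_msg k 0.
  apply: (@msum_inj_at k) => [i /negbTE ik|]; first by rewrite !ffunE ik.
  apply: (@decode_eq A _ _ q) => // x /Ak; rewrite !inE => kx.
  apply: locS => i ix; rewrite !ffunE; case: eqP => // ik.
  by rewrite -ik ix in kx.
move/ffunP/(_ k); rewrite !ffunE eqxx => /rowP/(_ (Ordinal L_gt0)).
by rewrite !mxE => /eqP; rewrite oner_eq0.
Qed.

Lemma sum_card_servers : (\sum_k #|[set x | k \in Z S x]| = \sum_x #|Z S x|)%N.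
Proof.
transitivity (\sum_k \sum_x (k \in Z S x : nat))%N.
  by apply: eq_bigr => k _; rewrite -sum1dep_card big_mkcond.
rewrite exchange_big; apply: eq_bigr => x _.
by rewrite -sum1_card [RHS]big_mkcond.
Qed.

(** Double counting: the number of pairs (server, stored dataset) is at least K M' and at most N M =
    K M', so every individual bound is tight. *)
Lemma storage_exact :
  (forall k, #|[set x | k \in Z S x]| = M') /\ (forall x, #|Z S x| = M).
Proof.
have le1 := leqif_sum (fun k (_ : true) => leqif_eq (card_servers_ge k)).
have le2 := leqif_sum (fun x (_ : true) => leqif_eq (storS x)).
move: le1 le2; rewrite sum_card_servers !sum_nat_const !card_ord.
have -> : (N * M = K * M')%N by rewrite /M mulnA [(N * _)%N]mulnC divnK.
move=> le1 le2; have E := leqif_trans le1 le2.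
have : [forall (k | true), M' == #|[set x | k \in Z S x]|] && [forall (x | true), #|Z S x| == M].
  by rewrite -E.
by case/andP=> /forallP H1 /forallP H2; split=> i; [rewrite -(eqP (H1 i)) | rewrite (eqP (H2 i))].
Qed.

(** Exactly N - M' = Nr - 1 servers lack dataset k. Together with x they decode the sum, and among
    them only x sees W_k. *)
Lemma server_inj x k (w w' : Msg) q : k \in Z S x -> 0 < pQ S q ->
  (forall i, i != k -> w i = w' i) -> psi S x w q = psi S x w' q -> w = w'.
Proof.
move=> kx q0 ww' psiE; apply: (msum_inj_at ww').
apply: (@decode_eq (x |: ~: [set y | k \in Z S y]) _ _ q) => //.
  rewrite cardsU1 !inE negbK kx.
  have := cardsC [set y | k \in Z S y]; rewrite (storage_exact.1 k) card_ord.
  have cardE a : (M' + a = N -> true + a = Nr)%N by rewrite /M'; move: Nr_le; lia.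
  exact: cardE.
move=> y; rewrite !inE => /predU1P[-> //|ky]; apply: locS => i iy.
by apply: ww'; apply: contraNneq ky => <-.
Qed.

Lemma card_Z_gt0 x : (0 < #|Z S x|)%N.
Proof.
rewrite storage_exact.2 /M muln_gt0 divn_gt0 // dvdn_leq //=.
by rewrite /M' addn1.
Qed.

(** With the other messages set to 0 and the randomness fixed, the transmission of x determines W_k
    for any k it stores, hence takes q^L values. *)
Lemma length_ge x : (L <= T S x)%N.
Proof.
have [q q0] := exists_pQ_gt0; have /card_gt0P[k kx] := card_Z_gt0 x.
have inj : injective (fun v => psi S x (at_msg k v) q).
  move=> v v' /(server_inj kx q0) E.
  have /ffunP/(_ k) : at_msg k v = at_msg k v'.
    by apply: E => i /negbTE ik; rewrite !ffunE ik.
  by rewrite !ffunE eqxx.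
have := leq_card _ inj; rewrite !card_mx !mul1n.
by rewrite leq_exp2l // card_finNzRing_gt1.
Qed.

Lemma comm_cost_ge : Nr%:R <= comm_cost S Nr.
Proof.
have [|A _ cA] := @exists_subset_card _ [set: 'I_N] Nr; first by rewrite cardsT card_ord.
rewrite /comm_cost ler_pdivlMr ?ltr0n // -natrM ler_nat.
apply: leq_trans (@leq_bigmax_cond _ _ _ A _); last by rewrite cA.
by rewrite -cA -sum_nat_const; apply: leq_sum => x _; apply: length_ge.
Qed.

(** [D] holds, for each server of the chain, a dataset that it stores and no earlier one does. The
    earlier servers do not see W_k for the dataset k of the head, so they settle the rest of [D] by
    induction; then the head settles W_k. *)
Lemma chain_inj s : chain (Z S) s -> exists D : {set 'I_K},
  [/\ #|D| = size s, D \subset covered (Z S) s &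
   forall (w w' : Msg) q, 0 < pQ S q -> (forall k, k \notin D -> w k = w' k) ->
     (forall x, x \in s -> psi S x w q = psi S x w' q) -> w = w'].
Proof.
elim: s => [_|x s IHs /= /andP[/subsetPn[k kx ks] /IHs[D [cD Ds HD]]]].
  exists set0; split; rewrite ?cards0 ?sub0set // => w w' q _ ww' _.
  by apply/ffunP=> k; apply: ww'; rewrite inE.
have kD : k \notin D by apply: contra ks; apply: (subsetP Ds).
exists (k |: D); split.
- by rewrite cardsU1 kD cD.
- by rewrite covered_cons setUSS // sub1set.
move=> w w' q q0 ww' psiE.
(* [w2] is [w'] with W_k taken from [w]; the earlier servers cannot tell it from [w']. *)
pose w2 : Msg := [ffun i => if i == k then w k else w' i].
have w_w2 : w = w2.
  apply: (HD _ _ q) => // [i iD|y ys].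
    rewrite ffunE; case: eqVneq => [->|ik] //.
    by apply: ww'; rewrite !inE negb_or ik.
  rewrite psiE ?inE ?ys ?orbT //; apply: locS => i iy.
  rewrite ffunE; case: eqVneq => [ik|] //; case/negP: ks.
  by rewrite -ik /covered (big_rem y) //= inE iy.
apply: (server_inj kx q0) => [i /negbTE ik|]; first by rewrite w_w2 ffunE ik.
by apply: psiE; rewrite inE eqxx.
Qed.

(** For each value of the randomness of positive probability, the messages with the given
    transmissions are determined by their entries outside [D]. *)
Lemma prob_chain s w q : chain (Z S) s -> 0 < pQ S q ->
  prob (fun w' q' => Xall w' q' == Xall w q) <= (#|{: V}| ^ size s)%:R^-1 :> R.
Proof.
move=> /chain_inj[D [cD _ HD]] _.
have sz : (size s <= K)%N by rewrite -cD -[leqRHS]card_ord max_card.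
have V0 := card_V_gt0 F L.
rewrite probE // ler_pdivrMr ?ltr0n ?card_Msg_gt0 // card_Msg.
have -> : (#|{: V}| ^ K = #|{: V}| ^ (K - size s) * #|{: V}| ^ size s)%N.
  by rewrite -expnD subnK.
rewrite natrM mulrCA mulVf ?mulr1; last first.
  by rewrite pnatr_eq0 expn_eq0 negb_and -lt0n V0.
rewrite -[leRHS]mul1r -[X in _ <= X * _]pS.2 mulr_suml; apply: ler_sum => q' _.
have := pS.1 q'; rewrite le_eqVlt => /predU1P[<-|q0]; first by rewrite !mul0r.
rewrite ler_wpM2l ?(ltW q0) // ler_nat.
have inj : {in [set w' | Xall w' q' == Xall w q] &,
    injective (fun w' : Msg => [ffun i => if i \in D then 0 else w' i] : Msg)}.
  move=> w1 w2; rewrite !inE => /eqP E1 /eqP E2 /ffunP E.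
  apply: (HD _ _ q') => // [i iD|x _].
    by have := E i; rewrite !ffunE (negbTE iD).
  by have /ffunP/(_ x) := etrans E1 (esym E2); rewrite !ffunE.
rewrite -(card_in_imset inj).
have -> : (#|{: V}| ^ (K - size s) = #|pffun_on (0%R : V) (~: D) {: V}|)%N.
  rewrite card_pffun_on; congr (_ ^ _)%N.
  by have := cardsC D; rewrite card_ord; lia.
apply: subset_leq_card; apply/subsetP=> _ /imsetP[w' _ ->].
apply/pffun_onP; split=> //; apply/subsetP=> i; rewrite !inE ffunE.
by case: (i \in D); rewrite ?eqxx.
Qed.

Lemma rand_size_ge : (hval N M')%:R - 1 <= rand_size S.
Proof.
have [|||||s [chs szs]] := @hval_chain N K (Z S) (K %/ N) M' => //.
- by rewrite /M' addn1.
- exact: storage_exact.1.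
- by rewrite divn_gt0 // dvdn_leq.
have lnF : 0 < ln #|{: F}|%:R by rewrite ln_gt0 // ltr1n card_finNzRing_gt1.
rewrite /rand_size ler_pdivlMr ?mulr_gt0 ?ltr0n //.
have -> : L%:R * ln #|{: F}|%:R = ln #|{: V}|%:R.
  by rewrite card_V natrX lnX // ltr0n (ltn_trans _ (card_finNzRing_gt1 F)).
rewrite mulrBl mul1r; apply: rand_ge_of_secure => //; first by case: secS.
by move=> w q q0; rewrite -szs; apply: prob_chain.
Qed.

End Converse.

(** * Vector configurations *)

Section Design.
Variable F : finFieldType.

(* The functionals [s i] are the servers and the vectors [p k] the datasets,
   dataset [k] being stored at server [i] when [s i *m p k != 0]. *)
Definition design (I J : finType) (M' M d : nat) : Prop :=
  exists (u : 'rV[F]_d) (s : I -> 'rV[F]_d) (p : J -> 'cV[F]_d),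
  [/\ forall k, u *m p k = 1,
      forall v : 'cV[F]_d, u *m v = 1 -> (M' <= #|[set i | s i *m v != 0%R]|)%N
    & forall i, (#|[set k | s i *m p k != 0%R]| <= M)%N].

Lemma design_transfer (I J I' J' : finType) M' M d (f : I' -> I) (g : J' -> J) :
  bijective f -> bijective g -> design I J M' M d -> design I' J' M' M d.
Proof.
move=> bf bg [u [s [p [up sv sp]]]].
exists u, (s \o f), (p \o g); split=> [k|v uv|i] /=; first exact: up.
  rewrite (_ : [set _ | _] = f @^-1: [set i | s i *m v != 0]).
    by rewrite on_card_preimset ?sv //; apply: onW_bij.
  by apply/setP=> i; rewrite !inE.
rewrite (_ : [set _ | _] = g @^-1: [set k | s (f i) *m p k != 0]).
  by rewrite on_card_preimset ?sp //; apply: onW_bij.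
by apply/setP=> k; rewrite !inE.
Qed.

Lemma eq_card_bij (A B : finType) : #|A| = #|B| -> exists f : A -> B, bijective f.
Proof.
move=> e; exists (enum_val \o cast_ord e \o enum_rank).
apply: bij_comp (enum_rank_bij A); apply: bij_comp (enum_val_bij B) _.
by exists (cast_ord (esym e)) => i; rewrite ?cast_ordK ?cast_ordKV.
Qed.

Lemma design_eq_card (I J I' J' : finType) M' M d : #|I'| = #|I| -> #|J'| = #|J| ->
  design I J M' M d -> design I' J' M' M d.
Proof.
by move=> /eq_card_bij[f bf] /eq_card_bij[g bg]; apply: design_transfer bf bg.
Qed.

Lemma card_set_sum (A B : finType) (P : pred (A + B)) :
  #|[set x | P x]| = (#|[set a | P (inl a)]| + #|[set b | P (inr b)]|)%N.
Proof. by rewrite -!sum1dep_card big_sumType. Qed.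

Lemma card_set_prod (A B : finType) (P : pred A) :
  #|[set x : A * B | P x.1]| = (#|[set a | P a]| * #|B|)%N.
Proof.
rewrite -cardsT -cardsX; congr #|pred_of_set _|.
by apply/setP=> -[a b]; rewrite !inE andbT.
Qed.

(** Servers and datasets are repeated while the dimension stays the same, matching [hval_scale]. *)
Lemma design_replicate (I J A B : finType) M' M d : design I J M' M d ->
  design (I * A)%type (J * B)%type (M' * #|A|) (M * #|B|) d.
Proof.
move=> [u [s [p [up sv sp]]]]; exists u, (s \o fst), (p \o fst).
split=> [k|v uv|i] /=; first exact: up.
  by rewrite (card_set_prod _ (fun i => s i *m v != 0)) leq_mul2r sv ?orbT.
by rewrite (card_set_prod _ (fun k => s i.1 *m p k != 0)) leq_mul2r sp orbT.
Qed.

Lemma cvec_normalize d (u : 'rV[F]_d) (v : 'cV[F]_d) : u *m v != 0 ->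
  exists2 a : F, a != 0 & u *m (a *: v) = 1.
Proof.
move=> uv; have a0 : (u *m v) 0 0 != 0.
  by apply: contra uv => /eqP E; apply/eqP/rowP=> i; rewrite !ord1 E mxE.
exists ((u *m v) 0 0)^-1; rewrite ?invr_eq0 //.
by rewrite -scalemxAr [u *m v]mx11_scalar scale_scalar_mx mxE mulr1n mulVf.
Qed.

Lemma scale_mulmx_neq0 d (s : 'rV[F]_d) (v : 'cV[F]_d) a : a != 0 ->
  (s *m (a *: v) != 0) = (s *m v != 0).
Proof. by move=> a0; rewrite -scalemxAr scalemx_eq0 (negbTE a0). Qed.

Lemma design_neq0 (I : finType) M' d (u : 'rV[F]_d) (s : I -> 'rV[F]_d) :
  (forall v : 'cV[F]_d, u *m v = 1 -> (M' <= #|[set i | s i *m v != 0%R]|)%N) ->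
  forall v : 'cV[F]_d, u *m v != 0 -> (M' <= #|[set i | s i *m v != 0%R]|)%N.
Proof.
move=> sv v /cvec_normalize[a a0 /sv]; congr (_ <= _)%N; apply: eq_card => i.
by rewrite !inE scale_mulmx_neq0.
Qed.

(** If u1 v1 + u2 v2 = 1, one of the two terms is nonzero, and the servers of that half already
    suffice. *)
Lemma design_join (I1 J1 I2 J2 : finType) M' M d1 d2 :
  design I1 J1 M' M d1 -> design I2 J2 M' M d2 ->
  design (I1 + I2)%type (J1 + J2)%type M' M (d1 + d2).
Proof.
move=> [u1 [s1 [p1 [up1 sv1 sp1]]]] [u2 [s2 [p2 [up2 sv2 sp2]]]].
exists (row_mx u1 u2).
exists (fun i => match i with inl i => row_mx (s1 i) 0 | inr i => row_mx 0 (s2 i) end).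
exists (fun k => match k with inl k => col_mx (p1 k) 0 | inr k => col_mx 0 (p2 k) end).
split=> [[k|k]|v|[i|i]].
- by rewrite mul_row_col mulmx0 addr0.
- by rewrite mul_row_col mulmx0 add0r.
- rewrite -[v]vsubmxK mul_row_col card_set_sum => uv.
  have [v1|v1] := eqVneq (u1 *m usubmx v) 0.
    rewrite v1 add0r in uv; apply: leq_trans (leq_addl _ _).
    apply: leq_trans (sv2 _ uv) _; apply: subset_leq_card.
    by apply/subsetP=> i; rewrite !inE mul_row_col mul0mx add0r.
  apply: leq_trans (leq_addr _ _).
  apply: leq_trans (design_neq0 sv1 v1) _; apply: subset_leq_card.
  by apply/subsetP=> i; rewrite !inE mul_row_col mul0mx addr0.
- rewrite card_set_sum -[leqRHS]addn0 leq_add //.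
    apply: leq_trans (sp1 i); apply: subset_leq_card.
    by apply/subsetP=> k; rewrite !inE mul_row_col mul0mx addr0.
  rewrite leqn0 cards_eq0; apply/eqP/setP=> k.
  by rewrite !inE mul_row_col mul0mx mulmx0 addr0 eqxx.
- rewrite card_set_sum -[leqRHS]add0n leq_add //.
    rewrite leqn0 cards_eq0; apply/eqP/setP=> k.
    by rewrite !inE mul_row_col mul0mx mulmx0 addr0 eqxx.
  apply: leq_trans (sp2 i); apply: subset_leq_card.
  by apply/subsetP=> k; rewrite !inE mul_row_col mul0mx add0r.
Qed.

(* Cone over the given design, with apex [col_mx 0 1], cut by the two
   parallel hyperplanes [u - c x], where x is the new coordinate. *)
Lemma design_double (I J A B : finType) m d (c : bool -> F) :
  injective c -> (forall b, c b != 0) -> #|A| = m -> (#|J| + #|B| <= 2 * m)%N ->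
  design I J m m d ->
  design (I + bool * A)%type (J * bool + B)%type (2 * m) (2 * m) (d + 1).
Proof.
move=> cI c0 Am JB [u [s [p [up sv sp]]]].
exists (row_mx 0 1).
exists (fun i => match i with
  inl i => row_mx (s i) 0 | inr (b, _) => row_mx u (- (c b)%:M) end).
exists (fun k => match k with
  inl (k, b) => col_mx (c b *: p k) 1 | inr _ => col_mx 0 1 end).
split=> [[[k b]|k]|v|[i|[b a]]].
- by rewrite mul_row_col mul0mx mul1mx add0r.
- by rewrite mul_row_col mul0mx mul1mx add0r.
- rewrite -[v]vsubmxK; move: (usubmx v) (dsubmx v) => x y.
  rewrite mul_row_col mul0mx mul1mx add0r => ->.
  have card_b (b : bool) (P : pred (bool * A)) : (forall a, P (b, a)) ->
      (#|[set a : A | true]| <= #|[set z : bool * A | P z]|)%N.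
    move=> Pb; rewrite -(card_imset [set a : A | true] (f := pair b)); last by move=> ? ? [].
    by apply: subset_leq_card; apply/subsetP=> z /imsetP[a _ ->]; rewrite inE.
  have cA : #|[set a : A | true]| = m by rewrite -Am -cardsT; apply: eq_card => a; rewrite !inE.
  rewrite card_set_sum; have [ux|ux] := eqVneq (u *m x) 0.
    (* If u x = 0, every server (b, a) takes the nonzero value - c b. *)
    apply: leq_trans (leq_addl _ _); rewrite -{1}Am -card_bool -card_prod -cardsT.
    apply: subset_leq_card; apply/subsetP=> -[b a] _.
    rewrite !inE mul_row_col ux add0r mulmx1 oppr_eq0.
    by rewrite -scalemx1 scalemx_eq0 (negbTE (c0 b)) oner_eq0.
  rewrite mul2n -addnn leq_add //.
    apply: leq_trans (design_neq0 sv ux) _; apply: subset_leq_card.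
    by apply/subsetP=> i; rewrite !inE mul_row_col mul0mx addr0.
  (* The old servers give m nonzero values because u x <> 0; the other m come from a b with u x <> c
     b, which exists as c takes two values. *)
  have [b ub] : exists b, u *m x != (c b)%:M.
    have [E|] := eqVneq (u *m x) (c true)%:M; last by exists true.
    exists false; rewrite E; apply/eqP => /(congr1 (fun M : 'M_1 => M 0 0)).
    by rewrite !mxE !mulr1n => /cI.
  rewrite -[leqLHS]cA; apply: (card_b b) => a.
  by rewrite mul_row_col mulmx1 subr_eq0.
- rewrite card_set_sum (_ : [set b : B | _] = set0) ?cards0 ?addn0.
    rewrite mulnC -card_bool.
    apply: leq_trans (_ : _ <= #|[set k | s i *m p k != 0%R]| * #|{: bool}|)%N _; last first.
      by rewrite leq_mul2r sp orbT.
    rewrite -(card_set_prod _ (fun k => s i *m p k != 0)).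
    apply: subset_leq_card.
    apply/subsetP=> -[k b]; rewrite !inE mul_row_col mul0mx addr0.
    by rewrite scale_mulmx_neq0.
  by apply/setP=> k; rewrite !inE mul_row_col mul0mx mulmx0 addr0 eqxx.
(* Server (b, a) vanishes at every dataset (k, b), so it stores at most the (k, ~~ b) and the copies
   of the apex. *)
- rewrite card_set_sum; apply: leq_trans JB; rewrite leq_add ?max_card //.
  rewrite -cardsT -(card_imset [set: J] (f := fun k => (k, ~~ b))); last by move=> ? ? [].
  apply: subset_leq_card; apply/subsetP=> -[k b']; rewrite !inE mul_row_col.
  rewrite -scalemxAr up mulmx1 scalemx1 subr_eq0 => cb.
  apply/imsetP; exists k => //; congr pair.
  by apply/eqP; rewrite -addbT addbC; move: cb; case: b b' => [] []; rewrite ?eqxx.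
Qed.

Definition row_powers d (a : F) : 'rV[F]_d := \row_i a ^+ i.

Definition poly_of_col d (v : 'cV[F]_d.+1) : {poly F} := \poly_(i < d.+1) v (inord i) 0.

Lemma row_powers_mul d a (v : 'cV[F]_d.+1) :
  row_powers d.+1 a *m v = ((poly_of_col v).[a])%:M.
Proof.
apply/matrixP=> i j; rewrite !ord1 !mxE mulr1n horner_poly.
by apply: eq_bigr => l _; rewrite !mxE inord_val mulrC.
Qed.

Lemma poly_of_colK d (q : {poly F}) : (size q <= d.+1)%N ->
  poly_of_col (\col_(i < d.+1) q`_i) = q.
Proof.
move=> sq; apply/polyP=> i; rewrite coef_poly; case: ltnP => di.
  by rewrite mxE inordK.
by rewrite nth_default // (leq_trans sq).
Qed.

(* Vectors are polynomials of degree at most [e], servers evaluate at distinct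
   points, [u] is the coefficient of X^e: a monic polynomial of degree [e] has at
   most [e] roots. Dataset k is the polynomial with the roots a_k, ..., a_(k+e-1),
   indices being taken cyclically. *)
Lemma design_cyclic n e : (e <= n)%N -> (n < #|F|)%N ->
  design 'I_n.+1 'I_n.+1 (n.+1 - e) (n.+1 - e) e.+1.
Proof.
move=> en nF.
have cardC_ge x y : (x <= e)%N -> (x + y = n.+1)%N -> (n.+1 - e <= y)%N by lia.
have cardC_le x y : (e <= x)%N -> (x + y = n.+1)%N -> (y <= n.+1 - e)%N by lia.
have [a aI] : exists a : 'I_n.+1 -> F, injective a.
  exists (fun i => enum_val (widen_ord nF i)) => i j /enum_val_inj/(congr1 val) /= ij.
  exact: val_inj.
(* Addition in ['I_n.+1] is modulo n + 1, and e <= n ensures that [inord i] has value i. *)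
pose q (k : 'I_n.+1) : {poly F} := \prod_(i < e) ('X - (a (k + inord i))%:P).
have szq k : size (q k) = e.+1.
  by rewrite size_prod_XsubC /index_enum -enumT size_enum_ord.
exists (\row_i (i == ord_max)%:R), (fun i => row_powers e.+1 (a i)), (fun k => \col_i (q k)`_i).
split=> [k|v uv|i].
- apply/matrixP=> i j; rewrite !ord1 !mxE (bigD1 ord_max) //= big1 => [|l /negbTE lm].
    rewrite !mxE eqxx mul1r addr0 /=.
    have /monicP := monic_prod_XsubC (index_enum 'I_e) xpredT (fun i : 'I_e => a (k + inord i)).
    by rewrite -/(q k) lead_coefE szq.
  by rewrite !mxE lm mul0r.
- have p1 : (poly_of_col v)`_e = 1.
    move/matrixP/(_ 0 0): uv; rewrite !mxE (bigD1 ord_max) //= big1 => [|l /negbTE lm].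
      rewrite !mxE eqxx mul1r addr0 coef_poly ltnSn => E.
      transitivity (v ord_max 0); last exact: E.
      by congr (v _ _); apply: val_inj; rewrite /= inordK.
    by rewrite !mxE lm mul0r.
  have p0 : poly_of_col v != 0.
    by apply: contra_eq_neq p1 => ->; rewrite coef0 eq_sym oner_eq0.
  pose r := [seq a i | i <- enum [set i | row_powers e.+1 (a i) *m v == 0]].
  have := max_poly_roots (rs := r) p0; rewrite size_map -cardE => lt_r.
  have := cardsC [set i | row_powers e.+1 (a i) *m v == 0]; rewrite card_ord.
  rewrite (_ : ~: _ = [set i | row_powers e.+1 (a i) *m v != 0]); last first.
    by apply/setP=> i; rewrite !inE.
  have: (#|[set i | row_powers e.+1 (a i) *m v == 0%R]| < e.+1)%N.
    apply: leq_trans (lt_r _ _) _.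
    - apply/allP=> x /mapP[i]; rewrite mem_enum inE row_powers_mul => /eqP E ->.
      by move/matrixP/(_ 0 0): E; rewrite !mxE mulr1n /root => ->.
    - by rewrite map_inj_uniq ?enum_uniq.
    - exact: size_poly.
  move=> lt_z; exact: cardC_ge lt_z.
(* [q k] vanishes at [a i] for the e distinct indices k = i - l with l < e. *)
- have Z_i : (e <= #|[set k | (row_powers e.+1 (a i) *m (\col_l (q k)`_l) == 0)%R]|)%N.
    have roots_i : #|[set i - (inord l : 'I_n.+1) | l : 'I_e]| = e.
      rewrite card_imset ?card_ord // => l1 l2 /addrI/oppr_inj/(congr1 val) /=.
      rewrite !inordK; first exact: val_inj.
        by apply: leq_trans (ltn_ord l2) _; apply: leqW.
      by apply: leq_trans (ltn_ord l1) _; apply: leqW.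
    rewrite -[leqLHS]roots_i.
    apply: subset_leq_card; apply/subsetP=> _ /imsetP[l _ ->]; rewrite inE.
    rewrite row_powers_mul poly_of_colK ?szq // /q horner_prod (bigD1 l) //=.
    by rewrite subrK hornerXsubC subrr mul0r raddf0.
  have := cardsC [set k | row_powers e.+1 (a i) *m (\col_l (q k)`_l) == 0%R].
  rewrite card_ord (_ : ~: _ = [set k | row_powers e.+1 (a i) *m (\col_l (q k)`_l) != 0]).
    exact: cardC_le Z_i.
  by apply/setP=> k; rewrite !inE.
Qed.

End Design.

(** * Configurations of dimension [hval] *)

Section DesignExistence.
Local Open Scope nat_scope.
Variable F : finFieldType.

Lemma design_cyclic_le n m : 0 < m <= n -> n <= #|F| ->
  design F 'I_n 'I_n m m (n - m).+1.
Proof.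
case: n => [|n] /andP[m0 mn] nF; first by lia.
have := @design_cyclic F n (n.+1 - m); rewrite subKn //; apply=> //; lia.
Qed.

(** Polynomials would give dimension 4 here. Doubling the configuration for (3, 2), with one copy of
    the apex, gives 3 + 2 * 2 servers and 2 * 3 + 1 datasets in dimension 3; it takes two distinct
    nonzero scalars. *)
Lemma design_7_4 : 3 <= #|F| -> design F 'I_7 'I_7 4 4 3.
Proof.
move=> F3; have [c cI c0] : exists2 c : bool -> F, injective c & forall b, (c b != 0)%R.
  have [x] : exists x : F, x \notin [:: 0; 1]%R.
    apply/existsP; apply: contraTT F3 => /existsPn F01; rewrite -leqNgt.
    apply: leq_trans (card_size [:: 0; 1]%R); apply: subset_leq_card.
    by apply/subsetP=> x _; move: (F01 x); rewrite negbK.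
  rewrite !inE negb_or => /andP[x0 x1].
  exists (fun b => if b then x else 1%R) => [[] [] // /eqP|[]]; rewrite ?oner_eq0 //.
    by rewrite (negbTE x1).
  by rewrite eq_sym (negbTE x1).
have cyc : design F 'I_3 'I_3 2 2 2 by apply: (@design_cyclic_le 3 2).
have := @design_double F 'I_3 'I_3 'I_2 'I_1 2 2 c cI c0 (card_ord _) _ cyc.
rewrite !card_ord => /(_ isT); apply: design_eq_card.
  by rewrite card_sum card_prod card_bool !card_ord.
by rewrite card_sum card_prod card_bool !card_ord.
Qed.

(** In this range [hval n m] is n - m + 1, the dimension reached by polynomials, except at (7,
    4). *)
Lemma design_base n m : 0 < m -> m <= n < 2 * m -> coprime n m -> m <= 4 ->
  maxn 3 n <= #|F| -> design F 'I_n 'I_n m m (hval n m).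
Proof.
move=> m0 /andP[mn n2] cop m4; rewrite geq_max => /andP[F3 nF].
have [/andP[/eqP -> /eqP ->]|n7] := boolP ((n == 7) && (m == 4)).
  exact: design_7_4.
have -> : hval n m = (n - m).+1.
  case: m m0 m4 mn n2 cop n7 {nF} => [|[|[|[|[|m]]]]] //;
  by case: n => [|[|[|[|[|[|[|[|n]]]]]]]] //; lia.
by apply: design_cyclic_le; rewrite ?m0.
Qed.

(** Splitting off m servers in dimension 1 lowers n by m and [hval] by 1, until n < 2m. *)
Lemma design_coprime n m : 0 < m -> m <= n -> coprime n m -> m <= 4 ->
  maxn 3 n <= #|F| -> design F 'I_n 'I_n m m (hval n m).
Proof.
move=> m0; elim/ltn_ind: n => n IHn mn cop m4 nF.
have [n2|n2] := ltnP n (2 * m); first by apply: design_base; rewrite ?mn.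
have nE : n = m + (n - m) by lia.
have D1 : design F 'I_m 'I_m m m 1.
  have := @design_cyclic_le m m; rewrite subnn; apply; first by rewrite m0 leqnn.
  by move: nF; rewrite geq_max; lia.
have {IHn}D2 : design F 'I_(n - m) 'I_(n - m) m m (hval (n - m) m).
  apply: IHn => //; [by lia|by lia| |].
    by move: cop; rewrite {1}nE /coprime ![gcdn _ m]gcdnC gcdnDl.
  by move: nF; rewrite !geq_max; lia.
have -> : hval n m = 1 + hval (n - m) m by rewrite {1}nE hvalDl.
by apply: design_eq_card (design_join D1 D2); rewrite card_sum !card_ord -nE.
Qed.

Lemma design_hval N K M' : 0 < N -> 0 < M' <= N -> N %| K -> M' %/ gcdn N M' <= 4 ->
  maxn 3 N <= #|F| -> design F 'I_N 'I_K M' (K %/ N * M') (hval N M').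
Proof.
move=> N0 /andP[m0 mn] NK m4; set g := gcdn N M' in m4 *.
have g0 : 0 < g by rewrite gcdn_gt0 m0 orbT.
have NE : N = g * (N %/ g) by rewrite mulnC divnK // dvdn_gcdl.
have ME : M' = g * (M' %/ g) by rewrite mulnC divnK // dvdn_gcdr.
have cop : coprime (N %/ g) (M' %/ g).
  by rewrite /coprime -(eqn_pmul2l g0) muln1 muln_gcdr -NE -ME.
move: (N %/ g) (M' %/ g) cop m4 NE ME => n m cop m4 NE ME.
rewrite geq_max => /andP[F3 NF].
have hE : hval N M' = hval n m by rewrite NE ME hval_scale.
have D : design F 'I_n 'I_n m m (hval n m).
  by apply: design_coprime => //; rewrite ?geq_max; nia.
(* Each server is repeated g times, and each dataset g (K / N) times, as K = (K / N) g n. *)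
have := design_replicate 'I_g 'I_(g * (K %/ N)) D; rewrite !card_ord hE => D'.
move: D'; have -> : m * g = M' by rewrite ME mulnC.
have -> : m * (g * (K %/ N)) = K %/ N * M' by rewrite ME mulnC mulnCA mulnA [RHS]mulnC mulnC.
apply: design_eq_card; first by rewrite card_prod !card_ord NE mulnC.
by rewrite card_prod !card_ord mulnA -[n * g]mulnC -NE mulnC divnK.
Qed.

End DesignExistence.

(** * Achievability *)

Section Secure.
Variables (F : finFieldType) (K N L : nat) (S : scheme F K N L).
Notation Msg := (Msg F K L).

(** The law of X given W depends only on the sum, so P(w, s) P(x, s) = P(w, x, s) P(s) and the
    integrand of the mutual information vanishes pointwise. *)
Lemma secure_of_invariant : (forall q, 0 < pQ S q) -> is_pmf S ->
  (forall (w1 w2 : Msg) x, msum w1 = msum w2 ->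
     \sum_q pQ S q *+ (Xall w1 q == x) = \sum_q pQ S q *+ (Xall w2 q == x)) ->
  secure_cond S.
Proof.
move=> q_gt0 pS inv; have W0 : 0 < #|{: Msg}|%:R :> R by rewrite ltr0n card_Msg_gt0.
(* [c w x] is P(X = x | W = w), and [fib w] counts the messages with the same sum as w. *)
pose c (w : Msg) x := \sum_q pQ S q *+ (Xall w q == x).
pose fib (w : Msg) := #|[set w' : Msg | msum w' == msum w]|%:R : R.
have c_gt0 w q : 0 < c w (Xall w q).
  rewrite /c (bigD1 q) //= eqxx ltr_pwDl ?mulr1n //; apply: sumr_ge0 => q' _.
  by rewrite mulrn_wge0 // ltW.
have fib_gt0 w : 0 < fib w.
  by rewrite ltr0n; apply/card_gt0P; exists w; rewrite inE.
rewrite /secure_cond /cmi /Defs.ent -!sumrN -!big_split /= big1 // => w _.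
rewrite -!sumrN -!big_split /= big1 // => q _.
rewrite -!mulrN -!mulrDr; apply/eqP; rewrite mulf_eq0; apply/orP; right; apply/eqP.
have -> : prob (fun (w' : Msg) (_ : 'I_(qn S)) => (w', msum w') == (w, msum w))
    = #|{: Msg}|%:R^-1.
  rewrite -(prob_msg pS w); apply: eq_bigr => w' _; apply: eq_bigr => q' _.
  by rewrite xpair_eqE andb_idr // => /eqP ->.
have -> : prob (fun (w' : Msg) (_ : 'I_(qn S)) => msum w' == msum w) = fib w / #|{: Msg}|%:R.
  by rewrite probE // -mulr_suml pS.2 mul1r.
have -> : prob (fun (w' : Msg) (q' : 'I_(qn S)) =>
    (w', Xall w' q', msum w') == (w, Xall w q, msum w)) = c w (Xall w q) / #|{: Msg}|%:R.
  rewrite prob_msg_sumE; congr (_ / _); rewrite (bigD1 w) //=.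
  rewrite [X in _ + X]big1 ?addr0 => [|w' /negbTE ww].
    by apply: eq_bigr => q' _; rewrite !xpair_eqE !eqxx andbT.
  by rewrite big1 // => q' _; rewrite !xpair_eqE ww.
have -> : prob (fun (w' : Msg) (q' : 'I_(qn S)) =>
    (Xall w' q', msum w') == (Xall w q, msum w)) = fib w * c w (Xall w q) / #|{: Msg}|%:R.
  have -> : fib w * c w (Xall w q)
      = \sum_(w' : Msg) (if msum w' == msum w then c w (Xall w q) else 0).
    by rewrite /fib mulr_natl cardsE -big_mkcond sumr_const.
  rewrite prob_msg_sumE; congr (_ / _); apply: eq_bigr => w' _; case: ifP => ww.
    transitivity (c w' (Xall w q)); last exact: (inv w' w (Xall w q) (eqP ww)).
    by apply: eq_bigr => q' _; rewrite xpair_eqE ww andbT.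
  by rewrite big1 // => q' _; rewrite xpair_eqE ww andbF.
rewrite !lnM ?mulr_gt0 ?invr_gt0 //; ring.
Qed.

End Secure.

(** * The linear scheme of a configuration *)

Section Construct.
Variables (F : finFieldType) (K N L d M' M : nat).
Variables (u : 'rV[F]_d) (s : 'I_N -> 'rV[F]_d) (p : 'I_K -> 'cV[F]_d).
Hypothesis up : forall k, u *m p k = 1.
Hypothesis sv : forall v : 'cV[F]_d, u *m v = 1 -> (M' <= #|[set i | s i *m v != 0%R]|)%N.
Hypothesis sp : forall i, (#|[set k | s i *m p k != 0%R]| <= M)%N.
Hypotheses (K_gt0 : (0 < K)%N) (L_gt0 : (0 < L)%N).

Definition mask_set : {set 'M[F]_(d, L)} := [set y | u *m y == 0].

(** The randomness of a [scheme] lives in an ordinal, so the masks are addressed by index. *)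
Definition mask (q : 'I_#|mask_set|) : 'M[F]_(d, L) := enum_val q.

Definition encoded (w : Msg F K L) (q : 'I_#|mask_set|) : 'M[F]_(d, L) :=
  \sum_k p k *m w k + mask q.

Definition linear_scheme : scheme F K N L :=
  @Scheme F K N L (fun i => [set k | s i *m p k != 0]) #|mask_set|
    (fun=> #|mask_set|%:R^-1) (fun=> L) (fun i w q => s i *m encoded w q).

Lemma mask_set_gt0 : (0 < #|mask_set|)%N.
Proof. by apply/card_gt0P; exists 0; rewrite inE mulmx0. Qed.

Lemma mulmx_mask q : u *m mask q = 0.
Proof. by have := enum_valP q; rewrite inE => /eqP. Qed.

(** Adding p_0 (v' - v) carries the fibre of y -> u y over v into the one over v', since u p_0 =
    1. *)
Lemma card_mask_set : (#|mask_set| * #|{: 'rV[F]_L}|)%N = #|{: 'M[F]_(d, L)}|.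
Proof.
apply: (@card_uniform_fiber _ _ (fun y : 'M[F]_(d, L) => u *m y) _ 0) => v v'.
exists (fun y => y + p (Ordinal K_gt0) *m (v' - v)); first exact: addIr.
by move=> y yv; rewrite mulmxDr mulmxA up mul1mx yv addrC subrK.
Qed.

Lemma mulmx_encoded w q : u *m encoded w q = msum w.
Proof.
rewrite mulmxDr mulmx_mask addr0 mulmx_sumr; apply: eq_bigr => k _.
by rewrite mulmxA up mul1mx.
Qed.

Lemma linear_scheme_pmf : is_pmf linear_scheme.
Proof.
split=> [q|]; first by rewrite /= invr_ge0.
by rewrite /= sumr_const card_ord -[LHS]mulr_natr mulVf // pnatr_eq0 -lt0n mask_set_gt0.
Qed.

Lemma linear_scheme_local : local_encoding linear_scheme.
Proof.
move=> i w w' q ww' /=; rewrite /encoded !mulmxDr !mulmx_sumr; congr (_ + _).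
apply: eq_bigr => k _; rewrite !mulmxA.
have [->|sk] := eqVneq (s i *m p k) 0; first by rewrite !mul0mx.
by rewrite ww' // inE.
Qed.

(** If u were outside the span of the s_i with i in A, some v would satisfy u v <> 0 and s_i v = 0
    on A, leaving at most N - Nr < M' servers nonzero at v. *)
Lemma linear_scheme_decodable Nr : (N < Nr + M')%N -> decodable linear_scheme Nr.
Proof.
move=> NrM A cA.
(* Rows outside A are set to 0, so the row space of [SA] is the span of the s_i with i in A. *)
pose SA := \matrix_(i < N, j < d) (if i \in A then s i 0 j else 0).
have rowSA i : row i SA = if i \in A then s i else 0.
  by apply/rowP=> j; rewrite !mxE; case: ifP; rewrite // mxE.
have uA : (u <= SA)%MS.
  rewrite submxE; move: (cokermx SA) (mulmx_coker SA) => C SC.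
  apply/eqP/rowP=> j; rewrite [RHS]mxE; pose v := col j C.
  have -> : (u *m C) 0 j = (u *m v) 0 0 by rewrite /v colE mulmxA -colE [RHS]mxE.
  have [-> |uv] := eqVneq (u *m v) 0; first by rewrite mxE.
  have := design_neq0 sv uv.
  suff : (#|[set i | s i *m v != 0%R]| <= #|~: A|)%N.
    by have := cardsC A; rewrite card_ord cA; lia.
  apply: subset_leq_card; apply/subsetP=> i; rewrite !inE; apply: contra => iA.
  have <- : row i SA = s i by rewrite rowSA iA.
  by rewrite -row_mul /v colE mulmxA SC mul0mx row0.
have /submxP[D] := uA; rewrite mulmx_sum_row => uE.
exists (fun x => \sum_(i in A) D 0 i *: (x i : 'rV[F]_L)); split.
  by move=> x x' xx'; apply: eq_bigr => i /xx' ->.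
move=> w q _; rewrite -(mulmx_encoded w q) uE mulmx_suml.
rewrite big_mkcond; apply: eq_bigr => i _; rewrite rowSA -scalemxAl ffunE /=.
by case: ifP; rewrite // mul0mx scaler0.
Qed.

(** For two message tuples with equal sums, the unmasked encodings differ by some D with u D = 0,
    and translation by D permutes the uniform masks. *)
Lemma linear_scheme_secure : secure_cond linear_scheme.
Proof.
apply: secure_of_invariant linear_scheme_pmf _ => [q|w1 w2 x w12].
  by rewrite /= invr_gt0 ltr0n mask_set_gt0.
pose D : 'M[F]_(d, L) := \sum_k p k *m w1 k - \sum_k p k *m w2 k.
have uD : u *m D = 0.
  rewrite mulmxBr !mulmx_sumr; apply/eqP; rewrite subr_eq0; apply/eqP.
  move: w12; rewrite /msum => w12.
  transitivity (\sum_k w1 k); first by apply: eq_bigr => k _; rewrite mulmxA up mul1mx.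
  by rewrite w12; apply: eq_bigr => k _; rewrite mulmxA up mul1mx.
have inD q : mask q + D \in mask_set by rewrite inE mulmxDr mulmx_mask uD addr0.
pose t q := enum_rank_in (inD q) (mask q + D).
have maskt q : mask (t q) = mask q + D by apply: enum_rankK_in.
have t_inj : injective t.
  move=> q q' /(congr1 mask); rewrite !maskt => /addIr; exact: enum_val_inj.
rewrite [RHS](reindex_inj t_inj) /=; apply: eq_bigr => q _; congr (_ *+ (_ == _)).
apply/ffunP=> i; rewrite !ffunE /= /encoded maskt; congr (_ *m _).
by rewrite [mask q + D]addrC addrA [_ + D]addrC subrK.
Qed.

Lemma linear_scheme_secure_scheme Nr : (N < Nr + M')%N -> secure_scheme linear_scheme M Nr.
Proof.
move=> NrM; split; [exact: linear_scheme_pmf | exact: sp | exact: linear_scheme_local | |].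
  exact: linear_scheme_decodable.
exact: linear_scheme_secure.
Qed.

Lemma linear_scheme_cost Nr : comm_cost linear_scheme Nr <= Nr%:R.
Proof.
rewrite /comm_cost ler_pdivrMr ?ltr0n // -natrM ler_nat.
by apply/bigmax_leqP => A /eqP <-; rewrite /= sum_nat_const.
Qed.

Lemma linear_scheme_rand : rand_size linear_scheme = d%:R - 1.
Proof.
have lnF : 0 < ln #|{: F}|%:R by rewrite ln_gt0 // ltr1n card_finNzRing_gt1.
have F0 : 0 < #|{: F}|%:R :> R by rewrite ltr0n (ltn_trans _ (card_finNzRing_gt1 F)).
have L0 : 0 < L%:R :> R by rewrite ltr0n.
have := card_mask_set; rewrite !card_mx mul1n => /(congr1 (fun n => ln n%:R)).
rewrite natrM !natrX lnM ?exprn_gt0 // ?ltr0n ?mask_set_gt0 // !lnX // natrM.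
move=> E; rewrite /rand_size.
have -> : ent (fun (_ : Msg F K L) (q : 'I_(qn linear_scheme)) => q) = ln #|mask_set|%:R.
  refine (ent_uniform linear_scheme_pmf mask_set_gt0 _) => w q.
  by rewrite prob_q //; apply: linear_scheme_pmf.
have LF0 := lt0r_neq0 (mulr_gt0 L0 lnF).
apply: (mulIf LF0); rewrite divfK //.
by rewrite mulrBl mul1r mulrA -E addrK.
Qed.

End Construct.

Theorem theorem7 (K N Nr : nat) :
  (0 < K)%N -> (0 < N)%N -> (0 < Nr)%N -> (Nr <= N)%N -> (N %| K)%N ->
  let M' := (N - Nr + 1)%N in
  let M := (K %/ N * M')%N in
  (M' %/ gcdn N M' <= 4)%N ->
  exists q0 : nat, forall (F : finFieldType), (q0 <= #|{: F}|)%N ->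
  forall L : nat, (0 < L)%N ->
    (exists S : scheme F K N L,
        comm_optimal M Nr S /\ rand_size S = (h N M')%:R - 1) /\
    (forall S : scheme F K N L,
        comm_optimal M Nr S -> (h N M')%:R - 1 <= rand_size S).
Proof.
(* N elements serve as evaluation points; 3 elements provide two distinct nonzero scalars for (7,
   4). *)
move=> K0 N0 Nr0 NrN NK M' M m4; exists (maxn 3 N) => F F3 L L0.
have M0 : (0 < M' <= N)%N by rewrite /M'; lia.
have [M1 M2] := andP M0; have hE : h N M' = hval N M' by rewrite h_hval.
split; last by move=> S [secS _]; rewrite hE; apply: rand_size_ge.
have [u [s [p [up sv sp]]]] := design_hval N0 M0 NK m4 F3.
have NM : (N < Nr + M')%N by rewrite /M'; lia.
exists (linear_scheme L u s p); split; last by rewrite hE; apply: linear_scheme_rand.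
split; first exact: (linear_scheme_secure_scheme up sv sp K0 L0 NM).
(* No secure scheme costs less than Nr, and the linear scheme costs at most Nr. *)
move=> S' secS'; apply: le_trans (comm_cost_ge K0 Nr0 NrN NK L0 secS').
exact: linear_scheme_cost.
Qed.
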